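(* Let $\mathbf{k}$ be a Noetherian commutative ring and let $V$ be a finitely generated FI-module over $\mathbf{k}$. Then there exist finitely many integer-valued polynomials $P_i(T)\in\mathbb Q[T]$ and nontrivial (finitely generated) $\mathbf{k}$-modules $W_i$ such that for all sufficiently large $n$, $$[V_n]=\sum_iP_i(n)\,[W_i]$$ in the Grothendieck group $K_0(\mathbf{k})$ of $\mathbf{k}$.
   Context: FI is the category of finite sets and injections. An FI-module over $\mathbf{k}$ is a functor $V$ from FI to $\mathbf{k}$-modules, $V_n=V(\{1,\dots,n\})$. $M(m)=\mathbf{k}[\mathrm{Hom}_{FI}(\{1,\dots,m\},-)]$; $V$ is finitely generated if it is a quotient of a finite direct sum of $M(m_i)$'s. $K_0(\mathbf{k})$ denotes the Grothendieck group of finitely generated $\mathbf{k}$-modules modulo short exact sequences. *)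

(* Defs.v *)
From HB Require Import structures.
From mathcomp Require Import all_boot all_order all_algebra ring_quotient.
From mathcomp Require Import boolp freeg.

Set Implicit Arguments.
Unset Strict Implicit.
Unset Printing Implicit Defensive.

Import Order.TTheory GRing.Theory Num.Theory.
Local Open Scope ring_scope.
Local Open Scope quotient_scope.

(* [comPzRingType] does not exclude the zero ring. *)
Section Noetherian.
Variable k : comPzRingType.

Definition is_ideal (I : k -> Prop) : Prop :=
  [/\ I 0, forall x y, I x -> I y -> I (x + y) & forall a x, I x -> I (a * x)].

Definition fg_ideal (I : k -> Prop) : Prop :=
  exists (n : nat) (e : 'I_n -> k), (forall i, I (e i)) /\
    forall x, I x -> exists c : 'I_n -> k, x = \sum_(i < n) c i * e i.

Definition noetherian : Prop := forall I, is_ideal I -> fg_ideal I.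

End Noetherian.

Section Modules.
Variable k : comPzRingType.

Definition fin_gen (M : lmodType k) : Prop :=
  exists (n : nat) (e : 'I_n -> M),
    forall x, exists c : 'I_n -> k, x = \sum_(i < n) c i *: e i.

Record fgmod := FGMod { fgmod_car :> lmodType k; fgmodP : fin_gen fgmod_car }.

Definition nontrivial (M : lmodType k) : Prop := exists x : M, x != 0.

Definition surjective (A B : Type) (f : A -> B) : Prop :=
  forall y, exists x, f x = y.

Definition short_exact (A B C : lmodType k)
    (f : {linear A -> B}) (g : {linear B -> C}) : Prop :=
  [/\ injective f, surjective g & forall b, g b = 0 <-> exists a, f a = b].

Lemma fin_gen_fin (M : lmodType k) (I : finType) (e : I -> M) :
  (forall x, exists c : I -> k, x = \sum_i c i *: e i) -> fin_gen M.
Proof.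
move=> eP; exists #|I|, (fun j => e (enum_val j)) => x.
have [c ->] := eP x; exists (fun j => c (enum_val j)).
by rewrite (reindex (@enum_val I predT)) //; apply/onW_bij/enum_val_bij.
Qed.

Lemma fin_gen_quot (M N : lmodType k) (f : {linear M -> N}) :
  surjective f -> fin_gen M -> fin_gen N.
Proof.
move=> fS [n [e eP]]; exists n, (f \o e) => y.
have [x <-] := fS y; have [c ->] := eP x; exists c.
by rewrite linear_sum; apply: eq_bigr => i _; rewrite linearZ.
Qed.

(* The finite direct sum of a family of modules, as a dependent product. *)
Section DirectSum.
Variables (I : finType) (M : I -> lmodType k).

Definition dsum : Type := {dffun forall i, M i}.
HB.instance Definition _ := Choice.on dsum.

Implicit Types x y z : dsum.
Definition dsum_zero : dsum := [ffun i => 0].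
Definition dsum_opp x : dsum := [ffun i => - x i].
Definition dsum_add x y : dsum := [ffun i => x i + y i].
Definition dsum_scale (a : k) x : dsum := [ffun i => a *: x i].

Lemma dsum_addA : associative dsum_add.
Proof. by move=> x y z; apply/ffunP=> i; rewrite !ffunE addrA. Qed.
Lemma dsum_addC : commutative dsum_add.
Proof. by move=> x y; apply/ffunP=> i; rewrite !ffunE addrC. Qed.
Lemma dsum_add0 : left_id dsum_zero dsum_add.
Proof. by move=> x; apply/ffunP=> i; rewrite !ffunE add0r. Qed.
Lemma dsum_addN : left_inverse dsum_zero dsum_opp dsum_add.
Proof. by move=> x; apply/ffunP=> i; rewrite !ffunE addNr. Qed.

HB.instance Definition _ :=
  GRing.isZmodule.Build dsum dsum_addA dsum_addC dsum_add0 dsum_addN.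

Lemma dsum_scaleA a b x : dsum_scale a (dsum_scale b x) = dsum_scale (a * b) x.
Proof. by apply/ffunP=> i; rewrite !ffunE scalerA. Qed.
Lemma dsum_scale1 : left_id 1 dsum_scale.
Proof. by move=> x; apply/ffunP=> i; rewrite !ffunE scale1r. Qed.
Lemma dsum_scaleDr : right_distributive dsum_scale +%R.
Proof. by move=> a x y; apply/ffunP=> i; rewrite !ffunE scalerDr. Qed.
Lemma dsum_scaleDl x : {morph dsum_scale^~ x : a b / a + b}.
Proof. by move=> a b; apply/ffunP=> i; rewrite !ffunE scalerDl. Qed.

HB.instance Definition _ := GRing.Zmodule_isLmodule.Build k dsum
  dsum_scaleA dsum_scale1 dsum_scaleDr dsum_scaleDl.

Lemma dsumD x y i : (x + y) i = x i + y i. Proof. by rewrite ffunE. Qed.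
Lemma dsumZ a x i : (a *: x) i = a *: x i. Proof. by rewrite ffunE. Qed.
Lemma dsum0 i : (0 : dsum) i = 0. Proof. by rewrite ffunE. Qed.

Lemma dsum_sumE (J : Type) (r : seq J) (P : pred J) (F : J -> dsum) i :
  (\sum_(j <- r | P j) F j) i = \sum_(j <- r | P j) F j i.
Proof.
by apply: (big_morph (fun x : dsum => x i)) => [x y|]; rewrite ?dsumD ?dsum0.
Qed.

End DirectSum.

Section DirectSumMap.
Variables (I : finType) (M N : I -> lmodType k).
Variable f : forall i, {linear M i -> N i}.

Definition dsum_map (x : dsum M) : dsum N := [ffun i => f i (x i)].

Lemma dsum_map_is_linear : linear dsum_map.
Proof. by move=> a x y; apply/ffunP=> i; rewrite !ffunE linearP. Qed.
HB.instance Definition _ :=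
  GRing.isLinear.Build k (dsum M) (dsum N) *:%R dsum_map dsum_map_is_linear.

End DirectSumMap.

Lemma fin_gen_ffun (X : finType) : fin_gen {ffun X -> k^o}.
Proof.
pose e h : {ffun X -> k^o} := [ffun h' => (h' == h)%:R].
apply: (@fin_gen_fin {ffun X -> k^o} X e) => x.
exists x; apply/ffunP => h; rewrite sum_ffunE (bigD1 h) //= !ffunE eqxx.
rewrite [X in _ + X]big1 ?addr0 => [|h' ne]; first exact/esym/mulr1.
by rewrite !ffunE eq_sym (negPf ne) scaler0.
Qed.

Lemma fin_gen_dsum (I : finType) (M : I -> lmodType k) :
  (forall i, fin_gen (M i)) -> fin_gen (dsum M).
Proof.
move=> /choice[n] /(_ _)/cid-/all_sig[e eP].
pose inc i (x : M i) : dsum M :=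
  [ffun j => if i =P j is ReflectT ij then ecast j (M j) ij x else 0].
have incE i x : inc i x i = x.
  by rewrite ffunE; case: eqP => // ii; rewrite eq_axiomK.
have incN i j x : i != j -> inc i x j = 0 by move=> ne; rewrite ffunE; case: eqP ne => // ->; rewrite eqxx.
apply: (@fin_gen_fin (dsum M) {i : I & 'I_(n i)}
  (fun p => inc (tag p) (e _ (tagged p)))) => x.
 have /all_sig[c cP] i := cid (eP i (x i)).
exists (fun p => c (tag p) (tagged p)).
rewrite -(@sig_big_dep _ _ _ _ _ xpredT (fun _ => xpredT)
  (fun i j => c i j *: inc i (e i j))) /=.
apply/ffunP=> i; rewrite dsum_sumE (bigD1 i) //= dsum_sumE.
rewrite [X in _ + X]big1 ?addr0 => [|j ne].
  by rewrite [LHS]cP; apply: eq_bigr => j _; rewrite dsumZ incE.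
by rewrite dsum_sumE big1 // => l _; rewrite dsumZ incN ?scaler0.
Qed.

End Modules.

Section FI.

Record injection (S T : finType) :=
  Injection { inj_fun :> {ffun S -> T}; injP : injectiveb inj_fun }.

HB.instance Definition _ S T := [isSub for @inj_fun S T].
HB.instance Definition _ S T := [Finite of injection S T by <:].

Lemma inj_id_subproof (S : finType) : injectiveb [ffun x : S => x].
Proof. by apply/injectiveP => x y; rewrite !ffunE. Qed.
Definition inj_id (S : finType) : injection S S :=
  Injection (inj_id_subproof S).

Lemma inj_comp_subproof (S T U : finType)
  (g : injection T U) (f : injection S T) : injectiveb [ffun x => g (f x)].
Proof.
apply/injectiveP => x y; rewrite !ffunE.
by move=> /(injectiveP _ (injP g)) /(injectiveP _ (injP f)).
Qed.
Definition inj_comp (S T U : finType) (g : injection T U) (f : injection S T) :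
  injection S U := Injection (inj_comp_subproof g f).

Lemma inj_comp1 (S T : finType) (f : injection S T) :
  inj_comp (inj_id T) f = f.
Proof. by apply/val_inj/ffunP => x; rewrite !ffunE. Qed.

Lemma inj_compA (S T U W : finType) (h : injection U W) (g : injection T U)
  (f : injection S T) : inj_comp (inj_comp h g) f = inj_comp h (inj_comp g f).
Proof. by apply/val_inj/ffunP => x; rewrite !ffunE. Qed.

End FI.

Section FIModules.
Variable k : comPzRingType.

Record FImodule := MkFImodule {
  FI_obj :> finType -> lmodType k;
  FI_map : forall S T : finType, injection S T -> {linear FI_obj S -> FI_obj T};
  FI_map_id : forall (S : finType) (x : FI_obj S), FI_map (inj_id S) x = x;
  FI_map_comp : forall (S T U : finType) (g : injection T U) (f : injection S T)
    (x : FI_obj S), FI_map (inj_comp g f) x = FI_map g (FI_map f x)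
}.

Record FImorphism (V W : FImodule) := MkFImorphism {
  FI_comp :> forall S : finType, {linear V S -> W S};
  FI_natural : forall (S T : finType) (f : injection S T) (x : V S),
    FI_comp T (FI_map V f x) = FI_map W f (FI_comp S x)
}.

Definition FI_epi (V W : FImodule) (phi : FImorphism V W) : Prop :=
  forall S : finType, surjective (phi S).

(* The free module on Hom_FI({1..m}, S) is modelled by the functions from this
   finite set to k; an injection f : S -> T acts by pushforward of functions,
   so that it sends the basis element h to f o h. *)
Section Free.
Variable m : nat.

Definition free_obj (S : finType) : lmodType k := {ffun injection 'I_m S -> k^o}.

Section FreeMap.
Variables (S T : finType) (f : injection S T).

Definition free_map (v : free_obj S) : free_obj T :=
  [ffun g => \sum_(h | inj_comp f h == g) v h].

Lemma free_map_is_linear : linear free_map.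
Proof.
move=> a u v; apply/ffunP => g; rewrite !ffunE scaler_sumr -big_split /=.
by apply: eq_bigr => h _; rewrite !ffunE.
Qed.
HB.instance Definition _ :=
  GRing.isLinear.Build k (free_obj S) (free_obj T) *:%R free_map
    free_map_is_linear.
End FreeMap.

Lemma free_map_id S (x : free_obj S) : free_map (inj_id S) x = x.
Proof.
apply/ffunP => g; rewrite ffunE (big_pred1 g) // => h.
by rewrite inj_comp1.
Qed.

Lemma free_map_comp (S T U : finType) (g : injection T U) (f : injection S T)
  (x : free_obj S) : free_map (inj_comp g f) x = free_map g (free_map f x).
Proof.
apply/ffunP => u; rewrite !ffunE.
rewrite (partition_big (inj_comp f) (fun t => inj_comp g t == u)) /=; last first.
  by move=> h; rewrite inj_compA.
apply: eq_bigr => t /eqP tu; rewrite ffunE; apply: eq_bigl => h.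
by rewrite inj_compA; case: (inj_comp f h =P t) => [->|]; rewrite ?tu ?eqxx ?andbF.
Qed.

Definition FI_free : FImodule :=
  MkFImodule (FI_map := fun S T f => free_map f : {linear _ -> _})
    free_map_id free_map_comp.
End Free.

Section Sum.
Variables (I : finType) (V : I -> FImodule).

Let obj (S : finType) : lmodType k := dsum (fun i => V i S).
Let map (S T : finType) (f : injection S T) : {linear obj S -> obj T} :=
  dsum_map (fun i => FI_map (V i) f).

Lemma FI_dsum_id S (x : obj S) : map (inj_id S) x = x.
Proof. by apply/ffunP => i; rewrite ffunE FI_map_id. Qed.

Lemma FI_dsum_comp (S T U : finType) (g : injection T U) (f : injection S T)
  (x : obj S) : map (inj_comp g f) x = map g (map f x).
Proof. by apply/ffunP => i; rewrite !ffunE FI_map_comp. Qed.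

Definition FI_dsum : FImodule := MkFImodule FI_dsum_id FI_dsum_comp.
End Sum.

Definition FI_fin_gen (V : FImodule) : Prop :=
  exists (d : nat) (m : 'I_d -> nat)
    (phi : FImorphism (FI_dsum (fun i => FI_free (m i))) V), FI_epi phi.

Lemma FI_fin_gen_obj (V : FImodule) (S : finType) :
  FI_fin_gen V -> fin_gen (V S).
Proof.
move=> [d [m [phi /(_ S) phiS]]]; apply: fin_gen_quot phiS _.
by apply: fin_gen_dsum => i; apply: fin_gen_ffun.
Qed.

Definition FI_at (V : FImodule) (hV : FI_fin_gen V) (n : nat) : fgmod k :=
  FGMod (FI_fin_gen_obj 'I_n hV).

End FIModules.

Section Grothendieck.
Variable k : comPzRingType.

(* For universe reasons the free abelian group on the large type [fgmod k] is
   not a [zmodType]. As usual, one takes the free abelian group on the (small)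
   set of isomorphism classes: the isomorphism class of M is encoded by the set
   of all pairs (n, N) such that M is isomorphic to k^n / N; see
   [isoclass_eqP]. *)
Definition presentation : Type := {n : nat & 'rV[k]_n -> Prop}.

Definition presents (M : lmodType k) (p : presentation) : Prop :=
  exists f : {linear 'rV[k]_(tag p) -> M},
    surjective f /\ forall v, f v = 0 <-> tagged p v.

Record isoclass := Isoclass {
  isoclass_set : presentation -> Prop;
  isoclassP : exists M : fgmod k, isoclass_set = presents M
}.

HB.instance Definition _ := gen_eqMixin isoclass.
HB.instance Definition _ := gen_choiceMixin isoclass.

Definition isoclass_of (M : fgmod k) : isoclass :=
  Isoclass (ex_intro _ M erefl).

Lemma fin_gen_presents (M : lmodType k) :
  fin_gen M -> exists p, presents M p.
Proof.
move=> [n [e eP]].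
pose f (v : 'rV[k]_n) : M := \sum_(i < n) v 0 i *: e i.
have f_lin : linear f.
  move=> a u v; rewrite /f scaler_sumr -big_split; apply: eq_bigr => i _.
  by rewrite !mxE scalerDl scalerA.
pose L := GRing.isLinear.Build k 'rV[k]_n M *:%R f f_lin.
pose F : {linear 'rV[k]_n -> M} := HB.pack f L.
exists (existT (fun n => 'rV[k]_n -> Prop) n (fun v => F v = 0)), F; split=> // x.
have [c ->] := eP x; exists (\row_i c i).
by apply: eq_bigr => i _; rewrite mxE.
Qed.

Lemma isoclass_eqP (M N : fgmod k) :
  isoclass_of M = isoclass_of N <->
  exists f : {linear M -> N}, bijective f.
Proof.
split=> [[eMN]|[f fbij]].
  have [p pM] := fin_gen_presents (fgmodP M).
  have : presents N p by rewrite -eMN.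
  case: pM => f [fS fK] [g [gS gK]].
  have fgE u v : f u = f v <-> g u = g v.
    by split=> /eqP; rewrite -subr_eq0 -linearB => /eqP; [move/fK/gK|move/gK/fK];
      rewrite linearB => /subr0_eq.
  have [s sK] := choice fS; have [t tK] := choice gS.
  have gs_lin : linear (g \o s).
    move=> a x y; rewrite /= -linearP; apply/fgE.
    by rewrite linearP !sK.
  pose L := GRing.isLinear.Build k M N *:%R (g \o s) gs_lin.
  exists (HB.pack (g \o s) L : {linear M -> N}); exists (f \o t) => x /=.
    by rewrite -[RHS]sK; apply/fgE; rewrite tK.
  by rewrite -[RHS]tK; apply/fgE; rewrite sK.
have [h fK hK] := fbij.
have h_lin : linear h.
  by move=> a x y; apply: (can_inj fK); rewrite linearP !hK.
pose L := GRing.isLinear.Build k N M *:%R h h_lin.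
pose H : {linear N -> M} := HB.pack h L.
have E : presents M = presents N.
  apply/funext => p; apply/propext; split=> [] [g [gS gK]].
    exists (f \o g : {linear _ -> _}); split=> [y|v /=].
      by have [x xE] := gS (h y); exists x; rewrite /= xE hK.
    rewrite -gK; split=> [e|->]; last exact: linear0.
    by apply: (can_inj fK); rewrite e linear0.
  exists (H \o g : {linear _ -> _}); split=> [y|v /=].
    by have [x xE] := gS (f y); exists x; rewrite /= xE fK.
  rewrite -gK; split=> [e|->]; last exact: (linear0 H).
  by rewrite -[g v]hK [h _]e linear0.
by rewrite /isoclass_of; move: (ex_intro _ N _) (ex_intro _ M _) => /=;
  rewrite E => a b; congr Isoclass; exact: Prop_irrelevance.
Qed.

(* The subgroup generated by the [B] - [A] - [C]. *)
Inductive ses_span : {freeg isoclass} -> Prop :=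
| Ses_span0 : ses_span 0
| Ses_spanB x y : ses_span x -> ses_span y -> ses_span (x - y)
| Ses_span_gen (A B C : fgmod k) (f : {linear A -> B}) (g : {linear B -> C}) :
    short_exact f g ->
    ses_span (<< isoclass_of B >> - << isoclass_of A >> - << isoclass_of C >>).

Definition ses_pred : {pred {freeg isoclass}} := fun x => `[< ses_span x >].

Lemma ses_pred_zmod_closed : zmod_closed ses_pred.
Proof.
split=> [|x y /asboolP hx /asboolP hy]; apply/asboolP; first exact: Ses_span0.
exact: Ses_spanB.
Qed.
HB.instance Definition _ :=
  GRing.isZmodClosed.Build {freeg isoclass} ses_pred ses_pred_zmod_closed.

Definition K0 : zmodType := Quotient.quot ses_pred.

Definition K0_class (M : fgmod k) : K0 := \pi_(K0) << isoclass_of M >>.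

Lemma K0_exact (A B C : fgmod k) (f : {linear A -> B}) (g : {linear B -> C}) :
  short_exact f g -> K0_class B = K0_class A + K0_class C.
Proof.
move=> fg; rewrite /K0_class -[RHS]raddfD /=; apply/eqP.
rewrite -Quotient.idealrBE opprD addrA; apply/asboolP.
exact: Ses_span_gen fg.
Qed.

End Grothendieck.

(* For such P, [Num.floor P.[n%:R]] is the integer P(n); see [floorK]. *)
Definition integer_valued (P : {poly rat}) : Prop :=
  forall z : int, P.[z%:~R] \is a Num.int.

(* Main.v *)
From HB Require Import structures.
Require Import Defs.
From mathcomp Require Import all_boot all_order all_algebra ring_quotient ring zify.
From mathcomp Require Import boolp.

Set Implicit Arguments.
Unset Strict Implicit.
Unset Printing Implicit Defensive.

Import Order.TTheory GRing.Theory Num.Theory.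
Local Open Scope ring_scope.

(** The proof compares V with an initial module, in the sense of Groebner
bases.

Choose an epimorphism onto V from a direct sum of free FI-modules M(m_i).  The
images of the standard basis generate every V_n, and they are indexed by
words: an injection h from {1..m} to {1..n} is written as the word of length n
whose letter at h(j) is j and whose other letters are 0, and the index i of the
summand is put in front.  Order words lexicographically.  For each word e, the
initial ideal of e consists of the scalars a such that a times the generator e
is a combination of smaller generators.  Adding the generators one at a time in
increasing order filters V_n with successive quotients k / (initial ideal of
e), so [V_n] is the sum of the classes of these cyclic modules
([K0_class_filtration], [K0_class_FI_at]).

The increasing injection from {1..n} to {1..n+1} that skips p inserts a letter 0
at position p in every word.  This preserves the lexicographic order, so the
induced map of V carries a relation with leading word e to one whose leading
word is e with a 0 inserted: inserting a 0 can only enlarge the initial ideal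
([initial_ideal_mono]).

What remains is combinatorial.  Fix the sequence s of nonzero letters; there
are finitely many choices.  The words with nonzero letters s are determined by
the lengths of their runs of zeros, and the initial ideal is a monotone
function of these lengths, with values in a poset that satisfies the ascending
chain condition because k is Noetherian.  By induction on s, the sum of the
classes over the words of length n is eventually a polynomial in n
([evpoly_words]): once the first run of zeros is long enough, its length no
longer matters ([words_stabilization]), so up to finitely many terms the sum is
a cumulative sum of an eventually polynomial function for a shorter s, and
cumulative sums of integer-valued polynomials are again integer-valued
polynomials ([evpoly_cumul]).  Cyclic modules that happen to be trivial have
class 0 and are dropped at the end. *)

(** * Antidifferences of integer-valued polynomials *)

Definition falling (j : nat) : {poly rat} := \prod_(i < j) ('X - (i%:R)%:P).

Lemma size_falling j : size (falling j) = j.+1.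
Proof. by rewrite size_prod_XsubC [index_enum _]unlock -enumT size_enum_ord. Qed.

Lemma falling_succ j (x : rat) :
  (falling j.+1).[x + 1] = (falling j.+1).[x] + (falling j *+ j.+1).[x].
Proof.
have hd : (falling j.+1).[x + 1] = (x + 1) * (falling j).[x].
  rewrite /falling big_ord_recl hornerM hornerXsubC subr0; congr (_ * _).
  rewrite !horner_prod; apply: eq_bigr => i _.
  by rewrite !hornerXsubC lift0 mulrS; ring.
rewrite hd /falling big_ord_recr /= hornerM hornerXsubC hornerMn -mulr_natl.
by rewrite mulrS; ring.
Qed.

(** By induction on the degree: subtracting a multiple of a falling factorial from
P lowers the degree, and [falling_succ] gives an antidifference of the falling
factorial. *)
Lemma antidifference (P : {poly rat}) :
  exists Q : {poly rat}, forall x, Q.[x + 1] = Q.[x] + P.[x].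
Proof.
have [n] := ubnP (size P); elim: n P => // n IHn P; rewrite ltnS => sP.
have [P0|nP0] := eqVneq (size P) 0.
  move/eqP: P0; rewrite size_poly_eq0 => /eqP->.
  by exists 0 => x; rewrite !horner0 addr0.
have [j sPj] : exists j, size P = j.+1 by exists (size P).-1; rewrite prednK ?lt0n.
pose c := lead_coef P.
have sR : (size (P - c *: falling j)%R < n)%N.
  apply: leq_ltn_trans (_ : j < n)%N; last by rewrite -sPj.
  have m : falling j \is monic by rewrite monic_prod_XsubC.
  apply/leq_sizeP => i; rewrite leq_eqVlt coefB coefZ => /predU1P[<-|ji].
    have := monicP m; rewrite /c /lead_coef sPj size_falling /= => ->.
    by rewrite mulr1 subrr.
  by rewrite !nth_default ?mulr0 ?subr0 ?size_falling ?sPj.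
have [Q QE] := IHn _ sR.
exists (Q + (c / j.+1%:R) *: falling j.+1) => x.
rewrite !hornerD !hornerZ QE falling_succ hornerMn -mulr_natr.
rewrite hornerD hornerN hornerZ; field.
by rewrite -mulrS pnatr_eq0.
Qed.

(** An antidifference with one integral value is integral at every integer, by
adding or subtracting values of P; normalizing it to vanish at N provides that
value and is what summation from N onwards needs. *)
Lemma antidifference_int (P : {poly rat}) (N : nat) : integer_valued P ->
  exists Q : {poly rat}, [/\ integer_valued Q, Q.[N%:R] = 0 &
    forall x, Q.[x + 1] = Q.[x] + P.[x]].
Proof.
move=> intP; have [Q QE] := antidifference P.
exists (Q - (Q.[N%:R])%:P); split=> [z||x].
- rewrite hornerD hornerN hornerC -[z](subrK (N%:Z)).
  elim/int_rec: (z - _) => [|m IH|m IH].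
  + by rewrite add0r subrr.
  + have -> : (m.+1%:Z + N%:Z)%:~R = (m%:Z + N%:Z)%:~R + 1 :> rat.
      by rewrite -addn1 PoszD !rmorphD /=; ring.
    by rewrite QE addrAC rpredD.
  + move: IH; have -> : (- m%:Z + N%:Z)%:~R = (- m.+1%:Z + N%:Z)%:~R + 1 :> rat.
      by rewrite -addn1 PoszD !rmorphD /= !rmorphN rmorphD /=; ring.
    by rewrite QE addrAC => /rpredB /(_ (intP (- m.+1%:Z + N%:Z))); rewrite addrK.
- by rewrite hornerD hornerN hornerC subrr.
- by rewrite !(hornerD, hornerN, hornerC) QE addrAC.
Qed.

(** * Eventually polynomial functions *)

Section EventuallyPolynomial.
Variables (L : Type) (G : zmodType) (phi : L -> G).

(** Here L indexes the classes phi l that may occur as coefficients.  The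
inductive form lets each closure property be checked one summand at a time. *)
Inductive polyfun : (nat -> G) -> Prop :=
| Polyfun0 : polyfun (fun=> 0)
| Polyfun_cons (P : {poly rat}) (l : L) (g : nat -> G) :
    integer_valued P -> polyfun g ->
    polyfun (fun n => phi l *~ Num.floor P.[n%:R] + g n).

Definition evpoly (f : nat -> G) : Prop :=
  exists g N, polyfun g /\ forall n, (N <= n)%N -> f n = g n.

Lemma polyfunD f g : polyfun f -> polyfun g -> polyfun (fun n => f n + g n).
Proof.
move=> pf pg; elim: pf => [|P l h iP _ IH].
  by under eq_fun do rewrite add0r.
by under eq_fun do rewrite -addrA; exact: Polyfun_cons.
Qed.

Lemma polyfun_const l : polyfun (fun=> phi l).
Proof.
have -> : (fun=> phi l) = (fun n => phi l *~ Num.floor (1%:P : {poly rat}).[n%:R] + 0).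
  by apply/funext => n; rewrite hornerC floor1 addr0.
by apply: Polyfun_cons (Polyfun0) => z; rewrite hornerC.
Qed.

Lemma polyfun_sum I (r : seq I) (F : I -> nat -> G) :
  (forall i, polyfun (F i)) -> polyfun (fun n => \sum_(i <- r) F i n).
Proof.
move=> pF; elim: r => [|i r IH].
  by under eq_fun do rewrite big_nil; exact: Polyfun0.
by under eq_fun do rewrite big_cons; exact: polyfunD.
Qed.

Lemma evpolyD f g : evpoly f -> evpoly g -> evpoly (fun n => f n + g n).
Proof.
move=> [f' [N [pf fE]]] [g' [M [pg gE]]]; exists (fun n => f' n + g' n), (maxn N M).
by split=> [|n]; [exact: polyfunD | rewrite geq_max => /andP[/fE-> /gE->]].
Qed.

Lemma evpoly_sum (I : eqType) (r : seq I) (F : I -> nat -> G) :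
  (forall i, i \in r -> evpoly (F i)) -> evpoly (fun n => \sum_(i <- r) F i n).
Proof.
elim: r => [|i r IH] pF.
  by under eq_fun do rewrite big_nil; exists (fun=> 0), 0%N; split=> //; exact: Polyfun0.
under eq_fun do rewrite big_cons; apply: evpolyD; first by apply: pF; rewrite mem_head.
by apply: IH => j jr; apply: pF; rewrite inE jr orbT.
Qed.

Lemma evpoly_eq f g N : evpoly f -> (forall n, (N <= n)%N -> g n = f n) -> evpoly g.
Proof.
move=> [h [M [ph hE]]] gE; exists h, (maxn N M); split=> // n.
by rewrite geq_max => /andP[/gE-> /hE].
Qed.

Lemma polyfun_shift t f : polyfun f ->
  exists g, polyfun g /\ forall n, g (n + t)%N = f n.
Proof.
elim=> [|P l h iP _ [g [pg gE]]]; first by exists (fun=> 0); split=> //; exact: Polyfun0.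
exists (fun n => phi l *~ Num.floor (P \Po ('X - (t%:R)%:P)).[n%:R] + g n); split.
  apply: Polyfun_cons => // z.
  by rewrite horner_comp hornerXsubC -[t%:R]/(t%:Z%:~R) -rmorphB /=.
by move=> n; rewrite gE horner_comp hornerXsubC natrD addrK.
Qed.

Lemma evpoly_shift t f : evpoly f -> evpoly (fun n => f (n - t)%N).
Proof.
move=> [f' [N [pf fE]]]; have [g [pg gE]] := polyfun_shift t pf.
exists g, (N + t)%N; split=> // n le; rewrite fE; last by lia.
by rewrite -gE subnK //; lia.
Qed.

Lemma polyfun_antidifference N f : polyfun f ->
  exists g, [/\ polyfun g, g N = 0 & forall n, g n.+1 = g n + f n].
Proof.
elim=> [|P l h iP _ [g [pg g0 gS]]].
  by exists (fun=> 0); split=> [||n] //; [exact: Polyfun0 | rewrite addr0].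
have [Q [iQ Q0 QS]] := antidifference_int N iP.
exists (fun n => phi l *~ Num.floor Q.[n%:R] + g n); split=> [||n].
- exact: Polyfun_cons.
- by rewrite Q0 floor0 g0 addr0.
- rewrite gS -natr1 QS floorDzr ?mulrzDr; first by rewrite addrACA.
  by have := iQ n.
Qed.

(** The initial values of f, where it need not agree with its polynomial form,
contribute a constant to the sum; the first hypothesis makes this constant an
integral combination of the classes. *)
Lemma evpoly_cumul f : (forall n, polyfun (fun=> f n)) -> evpoly f ->
  evpoly (fun n => \sum_(s < n) f s).
Proof.
move=> cf [f' [N [pf fE]]]; have [g [pg g0 gS]] := polyfun_antidifference N pf.
exists (fun n => \sum_(s < N) f s + g n), N; split.
  by apply: polyfunD pg; apply: polyfun_sum => i; exact: cf.
move=> n; elim: n => [|n IH] le.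
  by move: le; rewrite leqn0 => /eqP N0; rewrite N0 in g0 *; rewrite g0 addr0.
rewrite big_ord_recr /=; move: le; rewrite leq_eqVlt => /predU1P[eN|le].
  by rewrite -[in g _]eN g0 addr0 eN big_ord_recr.
by rewrite IH // gS -fE // addrA.
Qed.

End EventuallyPolynomial.

(** * Words with prescribed nonzero letters *)

Section Words.

Definition strip (w : seq nat) : seq nat := [seq c <- w | c != 0%N].

(** The words of length n whose nonzero letters are s in this order, provided
that s has no 0; see [mem_words]. *)
Fixpoint words (s : seq nat) (n : nat) : seq (seq nat) :=
  if n is n'.+1 then
    map (cons 0%N) (words s n') ++
      (if s is c :: s' then map (cons c) (words s' n') else [::])
  else if s is [::] then [:: [::]] else [::].

Lemma mem_words s n w : 0%N \notin s ->
  (w \in words s n) = (size w == n) && (strip w == s).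
Proof.
elim: n s w => [|n IH] [|c s] [|a w] //; rewrite [words _ _]/= mem_cat => s0.
- by rewrite orbF [RHS]/=; apply/negbTE/mapP => -[].
- rewrite orbF [size _]/= eqSS [strip _]/=; have [->|an0] := eqVneq a 0%N.
    by rewrite mem_map ?IH // => ? ? [].
  by rewrite andbF; apply/negbTE/mapP => -[? _ [] a0]; rewrite a0 in an0.
- by rewrite [RHS]/=; apply/negbTE/negP => /orP[] /mapP[].
have c0 : c != 0%N by move: s0; rewrite inE negb_or eq_sym => /andP[].
have s0' : 0%N \notin s by move: s0; rewrite inE negb_or => /andP[].
rewrite [size _]/= eqSS [strip _]/=; have [->|an0] := eqVneq a 0%N.
  rewrite mem_map ?IH //; last by move=> ? ? [].
  by rewrite orbC; case: mapP => // -[? _ [] e]; rewrite -e in c0.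
rewrite -[LHS]/(_ || _); case: mapP => [[? _ [] e]|_]; first by rewrite e in an0.
rewrite /= eqseq_cons; have [->|ac] := eqVneq a c.
  by rewrite mem_map ?IH // => ? ? [].
by rewrite andbF; apply/negbTE/mapP => -[? _ [] e]; rewrite e eqxx in ac.
Qed.

Lemma uniq_words s n : 0%N \notin s -> uniq (words s n).
Proof.
have ci c : injective (cons c : seq nat -> _) by move=> ? ? [].
elim: n s => [|n IH] [|c s] //= s0; first by rewrite cats0 map_inj_uniq ?IH.
move: (s0); rewrite inE negb_or => /andP[c0 s0'].
rewrite cat_uniq !map_inj_uniq // !IH // andbT /=.
apply/hasPn => _ /mapP[w _ ->]; apply/mapP => -[w' _ [] e].
by rewrite e eqxx in c0.
Qed.

(** Splits the sum according to the number t of zeros before the first nonzero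
letter. *)
Lemma sum_words_cons (G : zmodType) c s (f : seq nat -> G) n :
  \sum_(w <- words (c :: s) n) f w =
  \sum_(t < n) \sum_(w <- words s (n - t.+1)) f (nseq t 0%N ++ c :: w).
Proof.
elim: n f => [|n IH] f; first by rewrite big_ord0 big_nil.
by rewrite /= big_cat !big_map /= IH big_ord_recl addrC /= subn1.
Qed.

Variables (L : Type) (le : L -> L -> Prop).
Hypothesis le_refl : forall a, le a a.
Hypothesis le_trans : forall b a c, le a b -> le b c -> le a c.
Hypothesis le_anti : forall a b, le a b -> le b a -> a = b.
Hypothesis acc : forall u : nat -> L, (forall t, le (u t) (u t.+1)) ->
  exists T, forall t, (T <= t)%N -> u t = u T.

Lemma le_chain (u : nat -> L) : (forall t, le (u t) (u t.+1)) ->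
  forall s t, (s <= t)%N -> le (u s) (u t).
Proof.
move=> uS s t /subnK <-; elim: (t - s)%N => [|d IH] //.
exact: le_trans IH (uS _).
Qed.

(** The ascending chain condition for monotone sequences of monotone functions.
If the diagonal is constant from T0 on, then F t u is squeezed between two
diagonal terms as soon as t and u are at least T0; finitely many values of u
remain, and each of them has its own bound. *)
Lemma diagonal_stabilization (D : Type) (dom : D -> Prop) (F : nat -> nat -> D -> L) :
  (forall t u x, le (F t u x) (F t.+1 u x)) ->
  (forall t u x, le (F t u x) (F t u.+1 x)) ->
  (exists T, forall t x, dom x -> (T <= t)%N -> F t t x = F T T x) ->
  (forall u, exists T, forall t x, dom x -> (T <= t)%N -> F t u x = F T u x) ->
  exists T, forall t u x, dom x -> (T <= t)%N -> F t u x = F T u x.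
Proof.
move=> Ft Fu [T0 T0P] /choice[tau tauP].
exists (maxn T0 (\max_(u < T0) tau u)) => t u x dx.
have [uT|Tu] := ltnP u T0.
  have mT : (tau u <= \max_(u < T0) tau u)%N by rewrite (leq_bigmax (Ordinal uT)).
  move=> le_t; rewrite (tauP u t) // ?[RHS](tauP u) //; lia.
suff E v : (T0 <= v)%N -> F v u x = F T0 T0 x by move=> ?; rewrite !E //; lia.
move=> Tv; apply: le_anti.
  rewrite -(T0P (maxn u v)) //; last by lia.
  apply: (@le_trans (F v (maxn u v) x)).
    by apply: (le_chain (u := fun u => F v u x)) => //; lia.
  by apply: (le_chain (u := fun t => F t (maxn u v) x)) => //; lia.
apply: (@le_trans (F v T0 x)).
  by apply: (le_chain (u := fun t => F t T0 x)).
by apply: (le_chain (u := fun u => F v u x)).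
Qed.

Definition ins_mono (Phi : seq nat -> L) :=
  forall u v, le (Phi (u ++ v)) (Phi (u ++ 0%N :: v)).

Lemma strip_nil w : strip w = [::] -> w = nseq (size w) 0%N.
Proof. by elim: w => //= a w IH; case: eqP => //= -> /IH <-. Qed.

Lemma strip_cons w c s : strip w = c :: s ->
  exists t w', w = nseq t 0%N ++ c :: w' /\ strip w' = s.
Proof.
elim: w => //= a w IH; case: eqP => [->|_] /=.
  by move=> /IH[t [w' [-> sw']]]; exists t.+1, w'.
by case=> <- <-; exists 0%N, w.
Qed.

Lemma ins_mono_prefix Phi p : ins_mono Phi -> ins_mono (fun w => Phi (p ++ w)).
Proof. by move=> m u v; rewrite !catA. Qed.

Lemma ins_mono_nseq Phi t w : ins_mono Phi ->
  le (Phi (nseq t 0%N ++ w)) (Phi (nseq t.+1 0%N ++ w)).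
Proof.
by move=> m; rewrite -addn1 nseqD -catA; exact: m.
Qed.

(** Induction on s with [diagonal_stabilization], where u is the length of the
first run of zeros.  The bound T has to be uniform in w: infinitely many words
have the nonzero letters s. *)
Lemma words_stabilization s (Phi : nat -> seq nat -> L) :
  (forall t, ins_mono (Phi t)) -> (forall t w, le (Phi t w) (Phi t.+1 w)) ->
  exists T, forall t w, strip w = s -> (T <= t)%N -> Phi t w = Phi T w.
Proof.
elim: s Phi => [|c s IH] Phi im tm.
  have [||||T TP] := @diagonal_stabilization unit (fun=> True)
    (fun t u _ => Phi t (nseq u 0%N)).
  - by [].
  - by move=> t u _; have := ins_mono_nseq u [::] (im t); rewrite !cats0.
  - have [|T TP] := acc (u := fun t => Phi t (nseq t 0%N)).
      move=> t; apply: le_trans (tm _ _) _.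
      by have := ins_mono_nseq t [::] (im t.+1); rewrite !cats0.
    by exists T => t _ _; exact: TP.
  - move=> u; have [|T TP] := acc (u := fun t => Phi t (nseq u 0%N)).
      by move=> t; exact: tm.
    by exists T => t _ _; exact: TP.
  by exists T => t w /strip_nil -> Tt; exact: (TP t _ tt).
have pm t u : ins_mono (fun w => Phi t (nseq u 0%N ++ c :: w)).
  move=> v w; have := ins_mono_prefix (rcons (nseq u 0%N) c) (im t) v w.
  by rewrite !cat_rcons.
have [||||T TP] := @diagonal_stabilization (seq nat) (fun w => strip w = s)
  (fun t u w => Phi t (nseq u 0%N ++ c :: w)).
- by [].
- by move=> t u w; exact: ins_mono_nseq.
- by apply: IH => // t w; apply: le_trans (tm _ _) _; exact: ins_mono_nseq.
- by move=> u; apply: IH.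
by exists T => t w /strip_cons[u [w' [-> sw']]] Tt; exact: TP.
Qed.

Variables (G : zmodType) (phi : L -> G).

(** Write a word as t zeros, the letter c, and a word w for the tail of s.  For
t >= T the value of Phi is the same as for t = T, so the terms with t >= T add
up to a cumulative sum of the function H T, which is eventually polynomial by
induction, and finitely many shifts of functions H t remain. *)
Lemma evpoly_words s Phi : 0%N \notin s -> ins_mono Phi ->
  evpoly phi (fun n => \sum_(w <- words s n) phi (Phi w)).
Proof.
elim: s Phi => [|c s IH] Phi s0 im.
  have [|T TP] := acc (u := fun t => Phi (nseq t 0%N)).
    by move=> t; have := ins_mono_nseq t [::] im; rewrite !cats0.
  exists (fun=> phi (Phi (nseq T 0%N))), T; split; first exact: polyfun_const.
  move=> n /TP <-; suff -> : words [::] n = [:: nseq n 0%N] by rewrite big_seq1.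
  by elim: n => //= n ->.
have {}s0 : 0%N \notin s by move: s0; rewrite inE negb_or => /andP[].
pose Psi t w := Phi (nseq t 0%N ++ c :: w).
have Psim t : ins_mono (Psi t).
  move=> v w; have := ins_mono_prefix (rcons (nseq t 0%N) c) im v w.
  by rewrite !cat_rcons.
have [|T TP] := words_stabilization s Psim.
  by move=> t w; exact: ins_mono_nseq.
pose H t n := \sum_(w <- words s n) phi (Psi t w).
have Hev t : evpoly phi (H t) by exact: IH.
have Hc t n : polyfun phi (fun=> H t n).
  by apply: polyfun_sum => w; exact: polyfun_const.
have HT t n : (T <= t)%N -> H t n = H T n.
  move=> Tt; apply: eq_big_seq => w; rewrite mem_words // => /andP[_ /eqP sw].
  by rewrite (TP t).
apply: (@evpoly_eq _ _ _ (fun n => \sum_(t < T) H t (n - t.+1)%N +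
  \sum_(u < n - T) H T u) _ T).
  apply: evpolyD; first by apply: evpoly_sum => t _; exact: evpoly_shift.
  exact: (evpoly_shift T (evpoly_cumul (Hc T) (Hev T))).
move=> n Tn; rewrite sum_words_cons -(big_mkord xpredT (fun t => H t (n - t.+1)%N)).
rewrite (big_cat_nat (n := T)) //= big_mkord; congr (_ + _).
rewrite -{1}[T]add0n big_addn big_mkord (reindex_inj rev_ord_inj) /=.
apply: eq_bigr => t _; rewrite HT; last by lia.
by congr H; have := ltn_ord t; lia.
Qed.

End Words.

(** * Filtrations by cyclic modules in the Grothendieck group *)

Section Spans.
Variable k : comPzRingType.

Section LSpan.
Variables (M : lmodType k) (X : M -> Prop).

Inductive lspan : M -> Prop :=
| Lspan0 : lspan 0
| Lspan_gen a x y : X x -> lspan y -> lspan (a *: x + y).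

Lemma lspan_lin a x y : lspan x -> lspan y -> lspan (a *: x + y).
Proof.
move=> xX yX; elim: xX => [|b u v Xu _ IH]; first by rewrite scaler0 add0r.
by rewrite scalerDr scalerA -addrA; exact: Lspan_gen.
Qed.

Lemma lspan_sub x : X x -> lspan x.
Proof.
move=> Xx; rewrite -[x]addr0 -[x]scale1r.
by apply: Lspan_gen => //; exact: Lspan0.
Qed.

Definition lspan_pred : {pred M} := fun x => `[< lspan x >].

Lemma lspanP x : reflect (lspan x) (x \in lspan_pred).
Proof. exact: asboolP. Qed.

Lemma lspan_submod_closed : submod_closed lspan_pred.
Proof.
split=> [|a x y /lspanP hx /lspanP hy]; apply/lspanP; first exact: Lspan0.
exact: lspan_lin.
Qed.
HB.instance Definition _ :=
  GRing.isSubmodClosed.Build k M lspan_pred lspan_submod_closed.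

Definition submodule : Type := {x : M | x \in lspan_pred}.
HB.instance Definition _ := SubChoice.on submodule.
HB.instance Definition _ := [SubChoice_isSubLmodule of submodule by <:].

Definition in_span x (h : lspan x) : submodule :=
  exist (fun x => x \in lspan_pred) x (introT (lspanP x) h).

Lemma in_span_val (u : submodule) : lspan (val u).
Proof. exact/lspanP/valP. Qed.

End LSpan.

Lemma lspan_map (M N : lmodType k) (X : M -> Prop) (Y : N -> Prop)
    (f : {linear M -> N}) x :
  (forall x, X x -> lspan Y (f x)) -> lspan X x -> lspan Y (f x).
Proof.
move=> XY; elim=> [|a u v /XY Yu _ IH]; first by rewrite linear0; exact: Lspan0.
by rewrite linearP; exact: lspan_lin.
Qed.

Lemma lspan_incl (M : lmodType k) (X Y : M -> Prop) x :
  (forall x, X x -> lspan Y x) -> lspan X x -> lspan Y x.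
Proof.
exact: (@lspan_map M M X Y idfun).
Qed.

Lemma lspan_seq (M : lmodType k) (vs : seq M) x :
  lspan (fun v => v \in vs) x ->
  exists c : 'I_(size vs) -> k, x = \sum_i c i *: vs`_i.
Proof.
elim=> [|a u v uvs _ [c ->]].
  by exists (fun=> 0); rewrite big1 // => i _; rewrite scale0r.
have iu : (index u vs < size vs)%N by rewrite index_mem.
exists (fun i => c i + (if i == Ordinal iu then a else 0)).
under [RHS]eq_bigr do rewrite scalerDl.
rewrite big_split /= addrC; congr (_ + _).
rewrite (bigD1 (Ordinal iu)) //= eqxx nth_index // big1 ?addr0 // => i /negPf->.
by rewrite scale0r.
Qed.

Lemma fin_gen_submodule (M : lmodType k) (vs : seq M) :
  fin_gen (submodule (fun v => v \in vs)).
Proof.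
have g (i : 'I_(size vs)) : lspan (fun v => v \in vs) vs`_i.
  exact/lspan_sub/mem_nth.
exists (size vs), (fun i => in_span (g i)) => u.
have [c cE] := lspan_seq (in_span_val u); exists c; apply: val_inj.
by rewrite raddf_sum /= cE; apply: eq_bigr.
Qed.

Record ideal := Ideal { ideal_mem :> k -> Prop; idealP : is_ideal ideal_mem }.

Definition ideal_le (I J : ideal) : Prop := forall a, I a -> J a.

Lemma ideal_le_anti I J : ideal_le I J -> ideal_le J I -> I = J.
Proof.
case: I J => I Ii [J Ji] IJ JI.
have E : I = J by apply/funext => a; apply/propext; split; [exact: IJ|exact: JI].
by move: Ji {IJ JI}; case: J / E => Ji; congr Ideal; exact: Prop_irrelevance.
Qed.

Lemma ideal_le_refl I : ideal_le I I. Proof. by []. Qed.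

Lemma ideal_le_trans J I K : ideal_le I J -> ideal_le J K -> ideal_le I K.
Proof. by move=> IJ JK a /IJ/JK. Qed.

(** The union of the chain is finitely generated, and all its generators lie in
one term. *)
Lemma ideal_acc (u : nat -> ideal) : noetherian k ->
  (forall t, ideal_le (u t) (u t.+1)) ->
  exists T, forall t, (T <= t)%N -> u t = u T.
Proof.
move=> nk uS; have um := le_chain ideal_le_refl ideal_le_trans uS.
pose U a := exists t, u t a.
have [|n [e [eU eP]]] := nk U.
  split=> [|x y [s xs] [t yt]|a x [t xt]].
  - by exists 0%N; case: (idealP (u 0%N)).
  - exists (maxn s t); case: (idealP (u (maxn s t))) => _ + _; apply.
      by apply: (um s _ _ x); rewrite ?leq_maxl.
    by apply: (um t _ _ y); rewrite ?leq_maxr.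
  - by exists t; case: (idealP (u t)) => _ _; apply.
have [tau tauP] := choice eU.
exists (\max_i tau i) => t Tt; apply: ideal_le_anti; last exact: um.
move=> a ua; have [|c ->] := eP a; first by exists t.
have [I0 ID IM] := idealP (u (\max_i tau i)).
by apply: big_ind => // i _; apply: IM; apply: (um (tau i)) => //; rewrite leq_bigmax.
Qed.

Lemma colon_is_ideal (M : lmodType k) (X : M -> Prop) (x : M) :
  is_ideal (fun a => lspan X (a *: x)).
Proof.
split=> [|a b ha hb|a b hb]; first by rewrite scale0r; exact: Lspan0.
  by rewrite scalerDl -[a *: x]scale1r; exact: lspan_lin.
by rewrite -scalerA -[_ *: _]addr0; apply: lspan_lin => //; exact: Lspan0.
Qed.

(** The annihilator of the image of x in M / span X. *)
Definition colon (M : lmodType k) (X : M -> Prop) (x : M) : ideal :=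
  Ideal (colon_is_ideal X x).

(** The quotient module k / I. *)
Section CyclicModule.
Variable I : ideal.

Definition ideal_pred : {pred k} := fun a => `[< I a >].

Lemma ideal_zmod_closed : zmod_closed ideal_pred.
Proof.
have [I0 ID IM] := idealP I.
split=> [|x y /asboolP hx /asboolP hy]; apply/asboolP => //.
by rewrite -mulN1r; apply: ID => //; exact: IM.
Qed.
HB.instance Definition _ := GRing.isZmodClosed.Build k ideal_pred ideal_zmod_closed.

Definition cyclic : Type := Quotient.quot ideal_pred.
HB.instance Definition _ := GRing.Zmodule.on cyclic.

Definition cyclic_pi (a : k) : cyclic := \pi_(Quotient.quot ideal_pred)%qT a.

Lemma cyclic_piP a b : cyclic_pi a = cyclic_pi b <-> I (a - b).
Proof.
split=> [e|h]; last by apply/eqP; rewrite -Quotient.idealrBE; apply/asboolP.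
apply/asboolP; rewrite -[asbool _]/(_ \in ideal_pred) Quotient.idealrBE.
by rewrite -/(cyclic_pi a) e.
Qed.

Lemma cyclic_piD a b : cyclic_pi (a + b) = cyclic_pi a + cyclic_pi b.
Proof. exact: raddfD. Qed.

Lemma cyclic_pi0 : cyclic_pi 0 = 0.
Proof. exact: raddf0. Qed.

Lemma cyclic_pi_surj q : exists a, cyclic_pi a = q.
Proof. by exists (repr q); exact: reprK. Qed.

Definition cyclic_scale (a : k) (q : cyclic) : cyclic := cyclic_pi (a * repr q).

Lemma cyclic_scaleE a b : cyclic_scale a (cyclic_pi b) = cyclic_pi (a * b).
Proof.
apply/cyclic_piP; rewrite -mulrBr; have [_ _ IM] := idealP I; apply: IM.
by apply/cyclic_piP; exact: reprK.
Qed.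

Lemma cyclic_scaleA a b q : cyclic_scale a (cyclic_scale b q) = cyclic_scale (a * b) q.
Proof. by have [c <-] := cyclic_pi_surj q; rewrite !cyclic_scaleE mulrA. Qed.
Lemma cyclic_scale1 : left_id 1 cyclic_scale.
Proof. by move=> q; have [c <-] := cyclic_pi_surj q; rewrite cyclic_scaleE mul1r. Qed.
Lemma cyclic_scaleDr : right_distributive cyclic_scale +%R.
Proof.
move=> a q r; have [[c <-] [d <-]] := (cyclic_pi_surj q, cyclic_pi_surj r).
by rewrite -cyclic_piD !cyclic_scaleE mulrDr cyclic_piD.
Qed.
Lemma cyclic_scaleDl q : {morph cyclic_scale^~ q : a b / a + b}.
Proof.
by move=> a b; have [c <-] := cyclic_pi_surj q; rewrite !cyclic_scaleE mulrDl cyclic_piD.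
Qed.
HB.instance Definition _ := GRing.Zmodule_isLmodule.Build k cyclic
  cyclic_scaleA cyclic_scale1 cyclic_scaleDr cyclic_scaleDl.

Lemma cyclic_piM a b : cyclic_pi (a * b) = a *: cyclic_pi b.
Proof. by rewrite -cyclic_scaleE. Qed.

Lemma fin_gen_cyclic : fin_gen cyclic.
Proof.
exists 1%N, (fun=> cyclic_pi 1) => q; have [a <-] := cyclic_pi_surj q.
by exists (fun=> a); rewrite big_ord1 -cyclic_piM mulr1.
Qed.

Definition cyclic_fg : fgmod k := FGMod fin_gen_cyclic.
End CyclicModule.

Definition span_fg (M : lmodType k) (vs : seq M) : fgmod k :=
  FGMod (fin_gen_submodule vs).

(** For M = 0 the identities M -> M -> M form a short exact sequence, whence
[M] = [M] + [M]. *)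
Lemma K0_class_trivial (M : fgmod k) : ~ nontrivial M -> K0_class M = 0.
Proof.
move=> tM; have M0 (x : M) : x = 0.
  by apply/eqP/negPn/negP => x0; apply: tM; exists x.
have ex : short_exact (idfun : {linear M -> M}) (idfun : {linear M -> M}).
  split=> // [y|b]; first by exists y.
  by split=> _; [exists b | rewrite (M0 b)].
by have /eqP := K0_exact ex; rewrite -subr_eq0 opprD addNKr oppr_eq0 => /eqP.
Qed.

Lemma K0_class_iso (M N : fgmod k) (f : {linear M -> N}) :
  bijective f -> K0_class M = K0_class N.
Proof.
move=> fb; have MN : isoclass_of M = isoclass_of N by apply/isoclass_eqP; exists f.
by rewrite /K0_class MN.
Qed.

Lemma K0_class_span_nil (M : lmodType k) : K0_class (span_fg ([::] : seq M)) = 0.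
Proof.
apply: K0_class_trivial => -[[x xP] /eqP]; apply; apply: val_inj => /=.
by move/lspanP: xP => []//.
Qed.

Lemma K0_class_span_full (M : fgmod k) (vs : seq M) :
  (forall x, lspan (fun v => v \in vs) x) -> K0_class M = K0_class (span_fg vs).
Proof.
move=> full; symmetry; pose f := val : {linear span_fg vs -> M}.
apply: (@K0_class_iso _ _ f).
exists (fun x => in_span (full x)) => [x|x] //.
exact: val_inj.
Qed.

Lemma lspan_rcons (M : lmodType k) (vs : seq M) v x :
  lspan (fun u => u \in rcons vs v) x ->
  exists a, lspan (fun u => u \in vs) (x - a *: v).
Proof.
elim=> [|a u w uvs _ [b IH]].
  by exists 0; rewrite scale0r subr0; exact: Lspan0.
move: uvs; rewrite mem_rcons inE => /predU1P[->|uvs].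
  by exists (a + b); rewrite scalerDl opprD addrACA subrr add0r.
by exists b; rewrite -addrA; exact: Lspan_gen.
Qed.

(** The quotient of span (vs, v) by span vs is generated by v, and it is k
modulo the annihilator of v.  The quotient map sends x to the class of any a
such that x - a v lies in span vs, which is well defined modulo this
annihilator. *)
Lemma K0_class_span_rcons (M : lmodType k) (vs : seq M) v :
  K0_class (span_fg (rcons vs v)) =
  K0_class (span_fg vs) + K0_class (cyclic_fg (colon (fun u => u \in vs) v)).
Proof.
set X := fun u => u \in vs; set Y := fun u => u \in rcons vs v.
have XY x : lspan X x -> lspan Y x.
  by apply: lspan_incl => u uX; apply: lspan_sub; rewrite /Y mem_rcons; apply/orP; right.
pose f (x : span_fg vs) : span_fg (rcons vs v) :=
  in_span (XY _ (in_span_val x)).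
have f_lin : linear f by move=> a x y; exact: val_inj.
pose F : {linear span_fg vs -> span_fg (rcons vs v)} :=
  HB.pack f (GRing.isLinear.Build _ _ _ _ f f_lin).
have [c cP] := choice (fun x : span_fg (rcons vs v) => lspan_rcons (in_span_val x)).
have colE x a : lspan X (val x - a *: v) ->
    cyclic_pi (colon X v) (c x) = cyclic_pi (colon X v) a.
  move=> h; apply/cyclic_piP; rewrite /= scalerBl.
  have -> : c x *: v - a *: v = -1 *: (val x - c x *: v) + (val x - a *: v).
    by rewrite scaleN1r opprB addrA subrK.
  by apply: lspan_lin.
pose g x : cyclic_fg (colon X v) := cyclic_pi (colon X v) (c x).
have g_lin : linear g.
  move=> a x y; rewrite /g -cyclic_piM -cyclic_piD; apply: colE => /=.
  have -> : a *: val x + val y - (a * c x + c y) *: v =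
    a *: (val x - c x *: v) + (val y - c y *: v).
    by rewrite scalerDl -scalerA scalerBr opprD addrACA.
  by apply: lspan_lin; exact: cP.
pose H : {linear span_fg (rcons vs v) -> cyclic_fg (colon X v)} :=
  HB.pack g (GRing.isLinear.Build _ _ _ _ g g_lin).
apply: (@K0_exact _ _ _ _ F H); split.
- by move=> x y [/val_inj].
- move=> q; have [a <-] := cyclic_pi_surj q.
  have yP : lspan Y (a *: v).
    rewrite -[_ *: _]addr0; apply: Lspan_gen (Lspan0 _).
    by rewrite /Y mem_rcons mem_head.
  exists (in_span yP); apply: colE => /=; rewrite subrr; exact: Lspan0.
- move=> b; split=> [gb|[a <-]].
    have bX : lspan X (val b).
      rewrite -[val b](subrK (c b *: v)) -[_ - _]scale1r.
      apply: lspan_lin; first exact: cP.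
      have : cyclic_pi (colon X v) (c b) = cyclic_pi (colon X v) 0.
        by rewrite cyclic_pi0 -[LHS]/(H b) gb.
      by move/cyclic_piP; rewrite subr0.
    by exists (in_span bX); exact: val_inj.
  rewrite -[RHS](cyclic_pi0 (colon X v)).
  by apply: colE; rewrite scale0r subr0 /=; exact: in_span_val.
Qed.

(** The generators are added in increasing order.  A generator x e' with e' not
in es must vanish, so that the combinations of all smaller generators are the
combinations of those already added. *)
Lemma K0_class_filtration d (E : orderType d) (M : lmodType k) (x : E -> M)
    (es : seq E) :
  sorted <%O es ->
  (forall e e', e \in es -> (e' < e)%O -> e' \in es \/ x e' = 0) ->
  K0_class (span_fg (map x es)) =
  \sum_(e <- es)
    K0_class (cyclic_fg (colon (fun v => exists2 e', (e' < e)%O & v = x e') (x e))).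
Proof.
rewrite lt_sorted_pairwise.
elim/last_ind: es => [|es e IH]; first by rewrite big_nil K0_class_span_nil.
rewrite pairwise_rcons map_rcons K0_class_span_rcons => /andP[/allP ee sE] dE.
rewrite -cats1 big_cat big_seq1 IH //; last first.
  move=> e1 e2 e1s e21; have [||] := dE e1 e2 _ e21.
  - by rewrite mem_rcons inE e1s orbT.
  - rewrite mem_rcons inE.
    by case/predU1P => [e2e|]; [have := ee _ e1s; rewrite -e2e lt_gtF | left].
  - by right.
congr (_ + K0_class (cyclic_fg _)); apply: ideal_le_anti => a; apply: lspan_incl.
  by move=> _ /mapP[e' /ee e'e ->]; apply: lspan_sub; exists e'.
move=> _ [e' e'e ->]; have [||->] := dE e e' _ e'e; last exact: Lspan0.
- by rewrite mem_rcons mem_head.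
rewrite mem_rcons inE => /predU1P[e'E|e's]; first by rewrite e'E ltxx in e'e.
by apply: lspan_sub; apply: map_f.
Qed.

End Spans.

(** * Injections as words *)

Definition insert0 p (w : seq nat) : seq nat := take p w ++ 0%N :: drop p w.

Lemma size_insert0 p w : size (insert0 p w) = (size w).+1.
Proof. by rewrite size_cat /= addnS -size_cat cat_take_drop. Qed.

Lemma strip_insert0 p w : strip (insert0 p w) = strip w.
Proof. by rewrite /strip filter_cat /= -filter_cat cat_take_drop. Qed.

Lemma insert0_cat u v : insert0 (size u) (u ++ v) = u ++ 0%N :: v.
Proof. by rewrite /insert0 take_size_cat ?drop_size_cat. Qed.

Lemma lt_insert0 p (v w : seqlexi nat) :
  (v < w)%O -> ((insert0 p v : seqlexi nat) < insert0 p w)%O.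
Proof.
elim: p v w => [|p IH] v w vw.
  by rewrite /insert0 !take0 !drop0 ltxi_cons lexx.
case: w v vw => [|b w] [|a v]; rewrite ?ltxis0 //.
  move=> _; rewrite -[insert0 _ (b :: w)]/(b :: insert0 p w) -[insert0 _ _]/[:: 0%N].
  rewrite ltxi_cons leEnat leq0n; apply/implyP => _.
  by have := size_insert0 p w; case: (insert0 p w).
rewrite !ltxi_cons => /andP[-> /implyP h]; apply/implyP => /h.
exact: IH.
Qed.

Section Codes.
Local Open Scope nat_scope.

Lemma skip_subproof n (p : 'I_n.+1) : injectiveb [ffun x : 'I_n => lift p x].
Proof. by apply/injectiveP => x y; rewrite !ffunE => /lift_inj. Qed.

Definition skip n (p : 'I_n.+1) : injection 'I_n 'I_n.+1 :=
  Injection (skip_subproof p).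

Variable m : nat.

(** The preimage of x under h, shifted by one because 0 stands for a position
outside the image. *)
Definition letter n (h : injection 'I_m 'I_n) (x : nat) : nat :=
  if [pick j | h j == x :> nat] is Some j then j.+1 else 0.

Definition code n (h : injection 'I_m 'I_n) : seq nat := mkseq (letter h) n.

Lemma injection_inj (S T : finType) (h : injection S T) : injective h.
Proof. exact/injectiveP/injP. Qed.

Variant letter_spec n (h : injection 'I_m 'I_n) x : nat -> Prop :=
| LetterHit j of h j = x :> nat : letter_spec h x j.+1
| LetterHole of (forall j, h j != x :> nat) : letter_spec h x 0.

Lemma letterP n (h : injection 'I_m 'I_n) x : letter_spec h x (letter h x).
Proof.
rewrite /letter; case: pickP => [j /eqP hj|no]; first exact: LetterHit.
by apply: LetterHole => j; rewrite no.
Qed.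

Lemma letter_val n (h : injection 'I_m 'I_n) j : letter h (h j) = j.+1.
Proof.
case: letterP => [i /val_inj/injection_inj-> //|/(_ j)].
by rewrite eqxx.
Qed.

Lemma code_inj n : injective (@code n).
Proof.
move=> h h' e; apply/val_inj/ffunP => j; apply: val_inj => /=.
have := congr1 (fun w => nth 0 w (h j)) e; rewrite !nth_mkseq // letter_val.
by case: letterP => // i <- [] /val_inj ->.
Qed.

Lemma code_skip n (p : 'I_n.+1) (h : injection 'I_m 'I_n) :
  code (Defs.inj_comp (skip p) h) = insert0 p (code h).
Proof.
have hE j : Defs.inj_comp (skip p) h j = bump p (h j) :> nat by rewrite !ffunE.
have letE x y : (forall z : 'I_n, (bump p z == x) = (z == y :> nat)) ->
    letter (Defs.inj_comp (skip p) h) x = letter h y.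
  by move=> xy; rewrite /letter (@eq_pick _ _ (fun j => h j == y :> nat)) // => j;
    rewrite hE xy.
have pn := ltn_ord p.
apply: (@eq_from_nth _ 0) => [|x]; first by rewrite size_insert0 !size_mkseq.
rewrite size_mkseq => xn; rewrite nth_mkseq // nth_cat size_takel ?size_mkseq; last by lia.
case: ltngtP => xp.
- rewrite nth_take // nth_mkseq; last by lia.
  by apply: letE => z; rewrite /bump; lia.
- rewrite -[x - p]prednK ?subn_gt0 //= nth_drop nth_mkseq; last by lia.
  by apply: letE => z; rewrite /bump; lia.
- rewrite xp subnn /=; case: letterP => // j; rewrite hE /bump; lia.
Qed.

(** A nonzero letter occurs only once, so it can be located by [index]: this
recovers an injection from its word. *)
Lemma uniq_strip_index w c x : uniq (strip w) -> c != 0 -> x < size w ->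
  nth 0 w x = c -> index c w = x.
Proof.
elim: w x => // a w IH [|x] /= us c0 xw; first by move=> ->; rewrite eqxx.
move=> wx; have cw : c \in strip w.
  by rewrite mem_filter c0 -wx mem_nth.
have [ac|_] := eqVneq a c; first by rewrite ac c0 /= cw in us.
by rewrite (IH x) //; case: (a != 0) us => //= /andP[].
Qed.

Lemma codeP n w :
  (exists h : injection 'I_m 'I_n, code h = w) <->
  (size w == n) && perm_eq (strip w) (iota 1 m).
Proof.
split=> [[h <-]|/andP[/eqP sw pw]].
  rewrite size_mkseq eqxx; apply: uniq_perm.
  - rewrite /strip filter_map map_inj_in_uniq ?filter_uniq ?iota_uniq // => x y.
    rewrite !mem_filter /= => /andP[+ _] /andP[+ _].
    by case: letterP => // i <- _; case: letterP => // j <- _ [] /val_inj->.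
  - exact: iota_uniq.
  move=> c; rewrite mem_filter mem_iota add1n ltnS; apply/andP/andP.
    by case=> c0 /mapP[x _ cx]; move: c0; rewrite cx; case: letterP.
  case: c => [|c] [] // _ cm; split=> //; apply/mapP; exists (h (Ordinal cm) : nat).
    by rewrite mem_iota /=.
  by rewrite letter_val.
have us : uniq (strip w) by rewrite (perm_uniq pw) iota_uniq.
have wm c : 0 < c <= m -> c \in w.
  move=> cm; have : c \in strip w by rewrite (perm_mem pw) mem_iota; lia.
  by rewrite mem_filter => /andP[].
have wj (j : 'I_m) : j.+1 \in w by rewrite wm /=.
have jn (j : 'I_m) : index j.+1 w < n by rewrite -sw index_mem.
have hi : injectiveb [ffun j => Ordinal (jn j)].
  apply/injectiveP => i j; rewrite !ffunE => -[] /(congr1 (nth 0 w)).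
  by rewrite !nth_index // => -[] /val_inj.
exists (Injection hi); apply: (@eq_from_nth _ 0) => [|x]; first by rewrite size_mkseq.
rewrite size_mkseq => xn; rewrite nth_mkseq //.
case: letterP => [j /= <-|noh]; first by rewrite ffunE /= nth_index.
apply/esym/eqP/negPn/negP => c0; have xw : x < size w by rewrite sw.
have : nth 0 w x \in strip w by rewrite mem_filter c0 mem_nth.
rewrite (perm_mem pw) mem_iota => cm.
have cm' : (nth 0 w x).-1 < m by lia.
have := noh (Ordinal cm'); rewrite /= ffunE /= prednK ?lt0n //.
by rewrite (uniq_strip_index us c0 xw) ?eqxx.
Qed.

Definition codes n : seq (seq nat) :=
  [seq w | s <- permutations (iota 1 m), w <- words s n].

Lemma permutations_iota_nz s : s \in permutations (iota 1 m) -> 0 \notin s.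
Proof. by rewrite mem_permutations => /perm_mem->; rewrite mem_iota. Qed.

Lemma mem_codes n w :
  (w \in codes n) = (size w == n) && perm_eq (strip w) (iota 1 m).
Proof.
apply/allpairsPdep/andP => [[s [v [sP vs ->]]]|[sw pw]].
  move: vs; rewrite mem_words ?permutations_iota_nz // => /andP[-> /eqP->].
  by rewrite -mem_permutations.
have sP : strip w \in permutations (iota 1 m) by rewrite mem_permutations.
by exists (strip w), w; split=> //; rewrite mem_words ?permutations_iota_nz // sw /=.
Qed.

Lemma uniq_codes n : uniq (codes n).
Proof.
apply: allpairs_uniq_dep => [|s sP|]; first exact: permutations_uniq.
  by rewrite uniq_words // permutations_iota_nz.
move=> _ _ /allpairsPdep[s [v [sP vs ->]]] /allpairsPdep[s' [v' [sP' vs' ->]]] /= vv.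
rewrite vv in vs *; move: vs vs'; rewrite !mem_words ?permutations_iota_nz //.
by move=> /andP[_ /eqP <-] /andP[_ /eqP <-].
Qed.

End Codes.

(** * The initial ideals of an FI-module *)

Section Generators.
Variables (k : comPzRingType) (V : FImodule k) (d : nat) (m : 'I_d -> nat).
Local Notation free := (FI_dsum (fun i => FI_free k (m i))).
Variable phi : FImorphism free V.

(** The standard basis vector of summand i at the injection with code w, and 0
if there is no such injection.  Indexing by words instead of injections avoids
transport between the types of injections of different summands. *)
Definition basis n i (w : seq nat) : free 'I_n :=
  [ffun i' : 'I_d => [ffun h : injection 'I_(m i') 'I_n =>
     ((i' == i :> nat) && (code h == w))%:R : k^o]].

Lemma basisE n i w i' (h : injection 'I_(m i') 'I_n) :
  (basis n i w i' : {ffun injection 'I_(m i') 'I_n -> k^o}) h =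
  ((i' == i :> nat) && (code h == w))%:R.
Proof. by rewrite !ffunE. Qed.

(** An injection whose code has a 0 at position p misses p, hence factors
through [skip p]; so a word that is not a code stays so after insertion, and
both sides vanish together. *)
Lemma basis_skip n (p : 'I_n.+1) i w : size w = n ->
  FI_map free (skip p) (basis n i w) = basis n.+1 i (insert0 p w).
Proof.
move=> sw; apply/ffunP => i'; rewrite [LHS]ffunE; apply/ffunP => g.
rewrite [LHS]ffunE [RHS]basisE; under eq_bigr do rewrite basisE.
have [ii|ii] /= := eqVneq (i' : nat) i; last by rewrite big1.
have [gw|gw] := eqVneq (code g) (insert0 p w); last first.
  rewrite big1 // => h /eqP hg; case: eqP => // hw.
  by rewrite -hg code_skip hw eqxx in gw.
have [h hw] : exists h : injection 'I_(m i') 'I_n, code h = w.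
  have := (codeP (m i') n.+1 (insert0 p w)).1 (ex_intro _ g gw).
  by rewrite size_insert0 strip_insert0 eqSS => /codeP.
rewrite (bigD1 h) /=; last by apply/eqP/code_inj; rewrite code_skip hw gw.
rewrite hw eqxx big1 ?addr0 // => h' /andP[_ h'h].
by rewrite -hw (inj_eq (@code_inj _ _)) (negPf h'h).
Qed.

Lemma basis_eq0 n i w :
  (forall i' : 'I_d, i' = i :> nat -> w \notin codes (m i') n) -> basis n i w = 0.
Proof.
move=> no; apply/ffunP => i'; rewrite [RHS]ffunE; apply/ffunP => h.
rewrite basisE [RHS]ffunE; case: eqP => //= /no; case: eqP => // hw.
by rewrite mem_codes => /negP[]; apply/codeP; exists h.
Qed.

Lemma basis_span n (v : free 'I_n) :
  v = \sum_(i < d) \sum_(h : injection 'I_(m i) 'I_n)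
        (v i : {ffun injection 'I_(m i) 'I_n -> k^o}) h *: basis n i (code h).
Proof.
apply/ffunP => i; apply/ffunP => h; rewrite dsum_sumE sum_ffunE (bigD1 i) //=.
rewrite [X in _ + X]big1 ?addr0 => [|i' ne]; last first.
  rewrite dsum_sumE sum_ffunE big1 // => h' _.
  rewrite dsumZ [LHS]ffunE basisE (negPf (_ : (i : nat) != i')) ?scaler0 //.
  by rewrite eq_sym.
rewrite dsum_sumE sum_ffunE (bigD1 h) //= big1 ?addr0 => [|h' ne].
  by rewrite dsumZ [RHS]ffunE basisE !eqxx /= [RHS]mulr1.
by rewrite dsumZ [LHS]ffunE basisE (inj_eq (@code_inj _ _)) eq_sym (negPf ne) andbF scaler0.
Qed.

(** The word e carries the index of the summand as its first letter. *)
Definition generator n (e : seqlexi nat) : V 'I_n :=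
  if e is i :: w then phi 'I_n (basis n i w) else 0.

Definition generators n : seq (seqlexi nat) :=
  [seq nat_of_ord i :: w | i <- enum 'I_d, w <- codes (m i) n].

Lemma generator_eq0 n e : e \notin generators n -> generator n e = 0.
Proof.
case: e => // i w ne; rewrite /generator basis_eq0 ?linear0 // => i' ii.
apply: contra ne => wc; apply/allpairsPdep; exists i', w.
by rewrite mem_enum -ii.
Qed.

Lemma uniq_generators n : uniq (generators n).
Proof.
apply: allpairs_uniq_dep => [|i _|]; rewrite ?enum_uniq ?uniq_codes //.
by move=> [i w] [i' w'] _ _ /= [] /val_inj -> ->.
Qed.

Lemma generator_skip n (p : 'I_n.+1) i w : size w = n ->
  FI_map V (skip p) (generator n (i :: w)) = generator n.+1 (i :: insert0 p w).
Proof. by move=> sw; rewrite /= -FI_natural basis_skip. Qed.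

Definition initial_ideal n (e : seqlexi nat) : ideal k :=
  colon (fun v => exists2 e', (e' < e)%O & v = generator n e') (generator n e).

(** Applies the map induced by the injection that skips [size u] to a relation
a x_e = (combination of smaller generators).  Generators indexed by words of
the wrong length are 0, and the others go to smaller generators because
insertion preserves the lexicographic order; the position is shifted by one
past the summand index. *)
Lemma initial_ideal_mono i : ins_mono (@ideal_le k)
  (fun w => initial_ideal (size w) (i :: w)).
Proof.
move=> u v a.
have pn : (size u < (size (u ++ v)).+1)%N by rewrite size_cat ltnS leq_addr.
pose p := Ordinal pn; rewrite -insert0_cat size_insert0.
suff: initial_ideal (size (u ++ v)) (i :: u ++ v) a ->
    lspan (fun x => exists2 e',
        (e' < (i :: insert0 p (u ++ v) : seqlexi nat))%O & x = generator _ e')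
      (FI_map V (skip p) (a *: generator (size (u ++ v)) (i :: u ++ v))).
  by rewrite linearZ generator_skip.
apply: lspan_map => _ [e' e'e ->].
have [e'g|/generator_eq0->] := boolP (e' \in generators (size (u ++ v))); last first.
  by rewrite linear0; exact: Lspan0.
have [i' [w [_ + e'E]]] := allpairsPdep e'g.
rewrite mem_codes => /andP[/eqP sw _]; rewrite {e'g}e'E in e'e *.
rewrite generator_skip //; apply: lspan_sub; exists ((i' : nat) :: insert0 (size u) w) => //.
exact: (lt_insert0 (size u).+1 e'e).
Qed.

Hypothesis phi_epi : FI_epi phi.

Lemma generators_span n (x : V 'I_n) :
  lspan (fun v => v \in map (generator n) (generators n)) x.
Proof.
have [v <-] := phi_epi x; rewrite (basis_span v) linear_sum; apply/lspanP.
apply: rpred_sum => i _; rewrite linear_sum; apply: rpred_sum => h _.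
rewrite linearZ; apply: rpredZ; apply/lspanP/lspan_sub.
apply/mapP; exists ((i : nat) :: code h : seqlexi nat) => //.
apply/allpairsPdep; exists i, (code h); split=> //; first by rewrite mem_enum.
by rewrite mem_codes; apply/codeP; exists h.
Qed.

Lemma K0_class_FI_at (hV : FI_fin_gen V) n :
  K0_class (FI_at hV n) =
  \sum_(i < d) \sum_(s <- permutations (iota 1 (m i)))
    \sum_(w <- words s n) K0_class (cyclic_fg (initial_ideal (size w) ((i : nat) :: w))).
Proof.
pose es := sort <=%O (generators n).
have em e : (e \in es) = (e \in generators n) by rewrite mem_sort.
rewrite (@K0_class_span_full _ (FI_at hV n) (map (generator n) es)); last first.
  move=> x; apply: lspan_incl (generators_span x) => _ /mapP[e eg ->].
  by apply: lspan_sub; rewrite map_f ?em.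
rewrite K0_class_filtration ?sort_lt_sorted ?uniq_generators //; last first.
  move=> e e' _ _; rewrite em; case: (boolP (e' \in generators n)); first by left.
  by move=> /generator_eq0; right.
rewrite (perm_big (generators n)) ?perm_sort //= big_allpairs_dep /= big_enum /=.
apply: eq_bigr => i _; rewrite big_allpairs_dep /= big_seq [RHS]big_seq.
apply: eq_bigr => s sP; apply: eq_big_seq => w.
by rewrite mem_words ?(permutations_iota_nz sP) // => /andP[/eqP sw _]; rewrite sw.
Qed.

Lemma evpoly_FI_at (hV : FI_fin_gen V) : noetherian k ->
  evpoly (fun I : ideal k => K0_class (cyclic_fg I)) (fun n => K0_class (FI_at hV n)).
Proof.
move=> nk; rewrite (funext (K0_class_FI_at hV)).
apply: evpoly_sum => i _; apply: evpoly_sum => s sP.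
apply: (@evpoly_words _ (@ideal_le k)) (permutations_iota_nz sP) _ => //.
- exact: ideal_le_refl.
- exact: ideal_le_trans.
- exact: ideal_le_anti.
- by move=> u; exact: ideal_acc.
- exact: initial_ideal_mono.
Qed.
End Generators.

(** * Conclusion *)

(** Summands with a trivial cyclic module have class 0 and are skipped. *)
Lemma polyfun_nontrivial (k : comPzRingType) (f : nat -> K0 k) :
  polyfun (fun I : ideal k => K0_class (cyclic_fg I)) f ->
  exists (r : nat) (P : 'I_r -> {poly rat}) (W : 'I_r -> fgmod k),
    [/\ forall i, integer_valued (P i), forall i, nontrivial (W i) &
      forall n, f n = \sum_(i < r) K0_class (W i) *~ Num.floor (P i).[n%:R]].
Proof.
elim=> [|P I g iP _ [r [Q [W [iQ nW gE]]]]].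
  exists 0%N, (fun=> 0), (fun=> span_fg ([::] : seq k^o)).
  by split=> [[]|[]|n] //; rewrite big_ord0.
have [nI|tI] := pselect (nontrivial (cyclic_fg I)); last first.
  by exists r, Q, W; split=> // n; rewrite K0_class_trivial // mul0rz add0r.
exists r.+1, (fun i => oapp Q P (unlift ord0 i)),
  (fun i => oapp W (cyclic_fg I) (unlift ord0 i)).
split=> [i|i|n]; [by case: unliftP => [j|] _ //=; exact: iQ
  | by case: unliftP => [j|] _ //=; exact: nW |].
by rewrite big_ord_recl unlift_none gE; congr (_ + _); apply: eq_bigr => i _; rewrite liftK.
Qed.

Theorem theorem1p15 (k : comPzRingType) (V : FImodule k) :
  noetherian k -> forall hV : FI_fin_gen V,
  exists (r : nat) (P : 'I_r -> {poly rat}) (W : 'I_r -> fgmod k),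
    (forall i, integer_valued (P i)) /\
    (forall i, nontrivial (W i)) /\
    exists N : nat, forall n : nat, (N <= n)%N ->
      K0_class (FI_at hV n) =
        \sum_(i < r) K0_class (W i) *~ Num.floor (P i).[n%:R].
Proof.
move=> nk hV; have [d [m [phi phi_epi]]] := hV.
have [f [N [pf fE]]] := evpoly_FI_at phi_epi hV nk.
have [r [P [W [iP nW PE]]]] := polyfun_nontrivial pf.
exists r, P, W; split=> //; split=> //; exists N => n /fE ->; exact: PE.
Qed.
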